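(* Let $R_k^{\mathrm{outer}}(z)$, $R_k^{\mathrm{right}}(z)$, $R_k^{\mathrm{left}}(z)$ ($k\ge 0$) be the $2\times 2$ matrix-valued coefficient functions described in the context, with $R_0^{\mathrm{outer}}=R_0^{\mathrm{right}}=R_0^{\mathrm{left}}=I$, satisfying for all $k\ge 1$ the jump relation $$R_k^{\mathrm{outer}}(z)=R_k^{\mathrm{right}}(z)+\sum_{j=1}^k R_{k-j}^{\mathrm{right}}(z)\,\Delta_j^{\mathrm{right}}(z)\quad (z\in\partial U_\delta),$$ $$R_k^{\mathrm{outer}}(z)=R_k^{\mathrm{left}}(z)+\sum_{j=1}^k R_{k-j}^{\mathrm{left}}(z)\,\Delta_j^{\mathrm{left}}(z)\quad (z\in\partial \tilde U_\delta).$$ Define recursively, for $m\ge 1$, $$s_m^{\mathrm{right}}(z)=\Delta_m^{\mathrm{right}}(z)-\sum_{j=1}^{m-1}s_j^{\mathrm{right}}(z)\Delta_{m-j}^{\mathrm{right}}(z),\qquad s_m^{\mathrm{left}}(z)=\Delta_m^{\mathrm{left}}(z)-\sum_{j=1}^{m-1}s_j^{\mathrm{left}}(z)\Delta_{m-j}^{\mathrm{left}}(z).$$ Then the jump relation can be written as follows: for all $k\ge 1$, $$R_k^{\mathrm{right}}(z)=R_k^{\mathrm{outer}}(z)-\sum_{m=1}^k R_{k-m}^{\mathrm{outer}}(z)\,s_m^{\mathrm{right}}(z)\quad (z\in\partial U_\delta),$$ $$R_k^{\mathrm{left}}(z)=R_k^{\mathrm{outer}}(z)-\sum_{m=1}^k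 R_{k-m}^{\mathrm{outer}}(z)\,s_m^{\mathrm{left}}(z)\quad (z\in\partial \tilde U_\delta).$$
   Context: $U_\delta$ and $\tilde U_\delta$ are disjoint small disks of radius $\delta$ around $1$ and $-1$. In the Riemann--Hilbert (Deift--Zhou) analysis of the polynomials orthogonal on $[-1,1]$ with respect to $w(x)=(1-x)^\alpha(1+x)^\beta h(x)$ ($\alpha,\beta>-1$, $h$ real analytic and strictly positive on $[-1,1]$) there is a $2\times2$ matrix-valued function $R(z)$ with an asymptotic expansion $R(z)\sim I+\sum_{k\ge1}R_k(z)n^{-k}$ as $n\to\infty$. The coefficients $R_k$ are analytic in $\mathbb C\setminus(\partial U_\delta\cup\partial\tilde U_\delta)$ and $R_k(z)=\mathcal O(1/z)$ as $z\to\infty$. One writes $R_k^{\mathrm{right}}$, $R_k^{\mathrm{left}}$, $R_k^{\mathrm{outer}}$ for $R_k$ inside $U_\delta$, inside $\tilde U_\delta$, and outside both disks respectively, together with their boundary values on the circles (and $R_0=I$ everywhere). The $2\times2$ matrix functions $\Delta_k^{\mathrm{right}}$, $\Delta_k^{\mathrm{left}}$ ($k\ge1$) are the coefficients of the expansion $\Delta\sim\sum_{k\ge1}\Delta_k n^{-k}$ of the jump on the circles, where $R^{\mathrm{outer}}=R^{\mathrm{right}}(I+\Delta^{\mathrm{right}})$ on $\partial U_\delta$ and $R^{\mathrm{outer}}=R^{\mathrm{left}}(I+\Delta^{\mathrm{left}})$ on $\partial\tilde U_\delta$. The only properties of these objects relevant here are the additive jump relations stated in the claim. $I$ is the $2\times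 2$ identity matrix, and empty sums are zero. *)

(* Defs.v *)
From mathcomp Require Import all_boot all_order all_algebra.
From mathcomp Require Import complex.
From mathcomp Require Import boolp classical_sets reals.

Set Implicit Arguments.
Unset Strict Implicit.
Unset Printing Implicit Defensive.

Import Order.TTheory GRing.Theory Num.Theory.

Local Open Scope ring_scope.
Local Open Scope classical_set_scope.
Local Open Scope complex_scope.

Section Disks.
Variable R : realType.

(* The norm of R[i] takes values in R[i], hence the coercion of the radius. *)
Definition disk (a : R[i]) (delta : R) : set R[i] :=
  [set z | `|z - a| < delta%:C].

Definition circle (a : R[i]) (delta : R) : set R[i] :=
  [set z | `|z - a| = delta%:C].

End Disks.

Section Recursion.
Variables (K : pzRingType) (p : nat) (D : nat -> 'M[K]_p).

(* [:: s_1; ...; s_m], with s_j at position j.-1. *)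
Fixpoint s_prefix (m : nat) : seq 'M[K]_p :=
  if m is n.+1 then
    let s := s_prefix n in
    rcons s (D n.+1 - \sum_(1 <= j < n.+1) nth 0 s j.-1 *m D (n.+1 - j)%N)
  else [::].

(* Only the values at m >= 1 are meaningful; D 0 is never used. *)
Definition s_rec (m : nat) : 'M[K]_p := nth 0 (s_prefix m) m.-1.

Lemma size_s_prefix m : size (s_prefix m) = m.
Proof. by elim: m => //= m IH; rewrite size_rcons IH. Qed.

Lemma nth_s_prefix m j : (0 < j <= m)%N -> nth 0 (s_prefix m) j.-1 = s_rec j.
Proof.
elim: m => [|m IH] /andP[j0]; first by rewrite leqNgt j0.
rewrite leq_eqVlt => /orP[/eqP -> //|]; rewrite ltnS => jm.
rewrite /= nth_rcons size_s_prefix prednK // jm.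
by apply: IH; rewrite j0.
Qed.

Lemma s_recE m : (0 < m)%N ->
  s_rec m = D m - \sum_(1 <= j < m) s_rec j *m D (m - j)%N.
Proof.
case: m => // m _; rewrite {1}/s_rec /= nth_rcons size_s_prefix ltnn eqxx.
congr (_ - _); apply: eq_big_nat => j /andP[j0 jm].
by rewrite nth_s_prefix // j0.
Qed.

End Recursion.

Definition s_coef (R : realType) (Delta : nat -> R[i] -> 'M[R[i]]_2)
  (m : nat) (z : R[i]) : 'M[R[i]]_2 := s_rec (Delta^~ z) m.

(* Main.v *)
(* In terms of formal power series in 1/n, the recursion for the s_m says
   (1 - s) (1 + Delta) = 1. Hence R_outer (1 - s) and R_right both solve
   X (1 + Delta) = R_outer, and this equation determines the coefficients of X
   one after the other. *)
Require Import Defs.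
From mathcomp Require Import all_boot all_order all_algebra.
From mathcomp Require Import complex.
From mathcomp Require Import boolp classical_sets reals.

Set Implicit Arguments.
Unset Strict Implicit.
Unset Printing Implicit Defensive.

Import Order.TTheory GRing.Theory Num.Theory.

Local Open Scope ring_scope.
Local Open Scope classical_set_scope.
Local Open Scope complex_scope.

(* Both sums range over the triangle 1 <= m, m < n <= k, with n = j + m. *)
Lemma sum_nat_triangle (V : nmodType) (k : nat) (F : nat -> nat -> V) :
  \sum_(1 <= j < k.+1) \sum_(1 <= m < (k - j).+1) F j m =
  \sum_(1 <= n < k.+1) \sum_(1 <= m < n) F (n - m)%N m.
Proof.
transitivity (\sum_(1 <= j < k.+1) \sum_(1 <= n < k.+1 | (j < n)%N)
    F j (n - j)%N).
  apply: eq_big_nat => j /andP[j_gt0 j_le].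
  rewrite -(big_nat_widenl j.+1 1 k.+1 predT (fun n => F j (n - j)%N)) //.
  rewrite -[j.+1]add1n big_addn subSn //.
  by apply: eq_bigr => m _; rewrite addnK.
rewrite (exchange_big_dep xpredT) //=.
apply: eq_big_nat => n /andP[n_gt0 n_le].
rewrite -(big_nat_widen 1 n k.+1 predT (fun j => F j (n - j)%N)); last exact: ltnW.
(* Reversing [1 <= j < n] exchanges [j] with [n - j], so that [m] becomes the summation index. *)
rewrite big_nat_rev; apply: eq_big_nat => m /andP[m_gt0 m_lt].
by rewrite add1n subSS subKn // ltnW.
Qed.

(** The pointwise algebra of the claim, by strong induction on [k]. Factors never commute: each
    [s_rec D m] stays to the left of [D j], as in the recursion. Including [k = 0] in the conclusion
    lets the induction start from [A 0 = B 0]. *)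
Lemma convolution_inversion (K : pzRingType) (p : nat)
    (D A B : nat -> 'M[K]_p) :
    A 0%N = B 0%N ->
    (forall k, (1 <= k)%N ->
      B k = A k + \sum_(1 <= j < k.+1) A (k - j)%N *m D j) ->
  forall k, A k = B k - \sum_(1 <= m < k.+1) B (k - m)%N *m s_rec D m.
Proof.
move=> AB0 jump; elim/ltn_ind => -[_|k IH]; first by rewrite big_geq // subr0.
set l := k.+1 in IH *.
have -> : A l = B l - \sum_(1 <= j < l.+1) A (l - j)%N *m D j.
  by rewrite (jump l) // addrK.
congr (_ - _).
(* The induction hypothesis expands every [A (l - j)], down to [A 0] at [j = l]. *)
transitivity (\sum_(1 <= j < l.+1) B (l - j)%N *m D j -
    \sum_(1 <= j < l.+1) \sum_(1 <= m < (l - j).+1)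
      B (l - (j + m))%N *m s_rec D m *m D j).
  rewrite -sumrB; apply: eq_big_nat => j /andP[j_gt0 j_le].
  rewrite IH; last by rewrite /l ltn_subrL j_gt0.
  rewrite mulmxBl mulmx_suml; congr (_ - _).
  by apply: eq_bigr => m _; rewrite subnDA.
(* Grouping by [n = j + m], the right factor of [B (l - n)] is the recursive expression for
   [s_rec D n]. *)
rewrite sum_nat_triangle -sumrB.
apply: eq_big_nat => n /andP[n_gt0 n_le].
rewrite s_recE // mulmxBr mulmx_sumr; congr (_ - _).
apply: eq_big_nat => m /andP[m_gt0 m_lt].
by rewrite subnK ?mulmxA // ltnW.
Qed.

(** Triangle inequality through [z]; tangency is allowed since the disks are open. It is for
    evaluating [R_outer 0] on a circle, its value being given only off both disks. *)
Lemma circle_notin_disk (R : realType) (a b : R[i]) (delta : R) :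
  delta%:C + delta%:C <= `|a - b| -> forall z, circle a delta z ->
  ~ disk a delta z /\ ~ disk b delta z.
Proof.
rewrite /circle /disk => ab z /= za; split; first by rewrite za ltxx.
move=> zb; have := le_lt_trans ab (le_lt_trans (ler_distD z a b) _).
by move/(_ (delta%:C + delta%:C)); rewrite distrC za ltrD2l ltxx => /(_ zb).
Qed.

Theorem proposition4p1 (R : realType) (delta : R)
  (delta_gt0 : 0 < delta) (delta_lt1 : delta < 1)
  (R_outer R_right R_left : nat -> R[i] -> 'M[R[i]]_2)
  (Delta_right Delta_left : nat -> R[i] -> 'M[R[i]]_2)
  (R0_outer : forall z : R[i],
     ~ disk 1 delta z -> ~ disk (-1) delta z -> R_outer 0%N z = 1%:M)
  (R0_right : forall z : R[i],
     (disk 1 delta `|` circle 1 delta) z -> R_right 0%N z = 1%:M)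
  (R0_left : forall z : R[i],
     (disk (-1) delta `|` circle (-1) delta) z -> R_left 0%N z = 1%:M)
  (jump_right : forall (k : nat) (z : R[i]), (1 <= k)%N -> circle 1 delta z ->
     R_outer k z = R_right k z +
       \sum_(1 <= j < k.+1) R_right (k - j)%N z *m Delta_right j z)
  (jump_left : forall (k : nat) (z : R[i]), (1 <= k)%N -> circle (-1) delta z ->
     R_outer k z = R_left k z +
       \sum_(1 <= j < k.+1) R_left (k - j)%N z *m Delta_left j z) :
  (forall (k : nat) (z : R[i]), (1 <= k)%N -> circle 1 delta z ->
     R_right k z = R_outer k z -
       \sum_(1 <= m < k.+1) R_outer (k - m)%N z *m s_coef Delta_right m z) /\
  (forall (k : nat) (z : R[i]), (1 <= k)%N -> circle (-1) delta z ->
     R_left k z = R_outer k z -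
       \sum_(1 <= m < k.+1) R_outer (k - m)%N z *m s_coef Delta_left m z).
Proof.
(* Here 2 is the distance between the centres 1 and -1. *)
have dC : delta%:C + delta%:C <= 2 :> R[i].
  by rewrite -[2]/(1 + 1) lerD // lecR ltW.
split=> k z _ cz.
- apply: (convolution_inversion (D := Delta_right^~ z)
      (A := R_right^~ z) (B := R_outer^~ z)) => [|l l_gt0].
  + have [|z1 z2] := circle_notin_disk (b := -1) _ cz.
      by rewrite opprK -[1 + 1]/(2%:R) normr_nat.
    by rewrite R0_outer // R0_right //; right.
  + exact: jump_right.
- apply: (convolution_inversion (D := Delta_left^~ z)
      (A := R_left^~ z) (B := R_outer^~ z)) => [|l l_gt0].
  + have [|z1 z2] := circle_notin_disk (b := 1) _ cz.
      by rewrite -opprD normrN -[1 + 1]/(2%:R) normr_nat.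
    by rewrite R0_outer // R0_left //; right.
  + exact: jump_left.
Qed.
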